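(* Let $m,r,N,p$ be integers with $0<m<r\le N$ and $0\le p\le r-1$, let $F:\mathbb{T}\to\mathbb{C}$ be a function, and let $Z_N$ and $\Upsilon_m=\{\tilde z_0,\dots,\tilde z_{m-1}\}\subset Z_N$ be the node sets described in the context. Put $$\Lambda^{*}=\left\{L\in\Lambda_{-p,r-p-1}\;:\;L(\tilde z_k)=F(\tilde z_k),\ k=0,\dots,m-1\right\},\qquad \|\varphi\|_2=\Big(\sum_{z\in Z_N\setminus\Upsilon_m}|\varphi(z)|^2\Big)^{1/2}.$$ Then the minimization problem $$\min_{L\in\Lambda^{*}}\|F-L\|_2^2$$ has a unique solution, i.e. there is exactly one $L\in\Lambda^{*}$ at which the minimum is attained.
   Context: $\mathbb{T}=\{z\in\mathbb{C}:|z|=1\}$. For integers $a\le b$, $\Lambda_{a,b}=\operatorname{span}_{\mathbb{C}}\{z^a,\dots,z^b\}$ (Laurent polynomials with complex coefficients). Nodes: $Z_N=\{z_j\}_{j=0}^{N-1}$ with $z_j=e^{i(\theta_0+hj)}$, $h=2\pi/N$, for a fixed $\theta_0\in[0,2\pi)$. Let $\mu$ be a finite positive Borel measure on $[0,2\pi)$ with infinite support, and let $\rho_m$ be its monic Szegő polynomial of degree $m$, i.e. the monic polynomial of degree $m$ with $\int_0^{2\pi}\rho_m(e^{i\theta})\overline{g(e^{i\theta})}\,d\mu(\theta)=0$ for every polynomial $g$ of degree at most $m-1$. Put $\rho_m^{*}(z)=z^m\overline{\rho_m(1/\bar z)}$, $\tau_m=-\rho_m(z_0)/\rho_m^{*}(z_0)\in\mathbb{T}$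 and $B_m(z,\tau_m)=\rho_m(z)+\tau_m\rho_m^{*}(z)$ (a para-orthogonal polynomial). It is known that $B_m(\cdot,\tau_m)$ has $m$ distinct zeros $\xi_0,\dots,\xi_{m-1}$, all on $\mathbb{T}$; they are labelled counterclockwise with $\xi_0=z_0$. Standing assumption: there is a set $\Upsilon_m=\{\tilde z_k\}_{k=0}^{m-1}\subset Z_N$ of $m$ pairwise distinct points such that $\tilde z_0=z_0=\xi_0$ and, for each $k=1,\dots,m-1$, $\tilde z_k$ is a point of $Z_N$ closest to $\xi_k$, i.e. $|\xi_k-\tilde z_k|=\min_{0\le j\le N-1}|\xi_k-z_j|$ (in case of a tie, either closest point may be chosen). Such a set $\Upsilon_m$ is fixed. *)

(* Defs.v *)
From mathcomp Require Import all_boot all_order all_algebra.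
From mathcomp Require Import complex.
From mathcomp Require Import all_classical all_reals all_analysis.

Set Implicit Arguments.
Unset Strict Implicit.
Unset Printing Implicit Defensive.

Import Order.TTheory GRing.Theory Num.Theory.
Import numFieldNormedType.Exports.

Local Open Scope classical_set_scope.
Local Open Scope ring_scope.

Definition circle (R : realType) : Type := {z : R[i] | `|z| == 1}.

Definition cis (R : realType) (t : R) : R[i] := (cos t +i* sin t)%C.

Lemma norm_cis (R : realType) (t : R) : `|cis t| == 1.
Proof. by rewrite normc_def /= cos2Dsin2 sqrtr1. Qed.

Definition expi (R : realType) (t : R) : circle R := exist _ (cis t) (norm_cis t).

(* A Laurent polynomial is determined by its values on the unit circle, so it
   is represented by the function it induces there.  For a <= b the exponents
   below are exactly a, a + 1, ..., b. *)
Definition Laurent (R : realType) (a b : int) : set (circle R -> R[i]) :=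
  [set L | exists c : 'I_(`|b - a|%N.+1) -> R[i],
     forall z : circle R, L z = \sum_i c i * sval z ^ (a + i%:Z)].

Definition node (R : realType) (theta0 : R) (N j : nat) : circle R :=
  expi (theta0 + 2 * pi / N%:R * j%:R).

Definition nodes (R : realType) (theta0 : R) (N : nat) : set (circle R) :=
  [set node theta0 N j | j in [set j | (j < N)%N]].

(* Measures on [0, 2 pi[ are finite Borel measures on R that vanish outside
   [0, 2 pi[. *)
Definition angles (R : realType) : set R := [set t | 0 <= t < 2 * pi].
Arguments angles R : clear implicits.

Definition msupport (R : realType)
    (mu : {finite_measure set (measurableTypeR R) -> \bar R}) : set R :=
  [set t | angles R t /\ forall U : set R, open U -> U t -> (0 < mu U)%E].

Definition cintegral (R : realType)
    (mu : {finite_measure set (measurableTypeR R) -> \bar R})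
    (f : R -> R[i]) : R[i] :=
  ((\int[mu]_(t in angles R) complex.Re (f t))
     +i* (\int[mu]_(t in angles R) complex.Im (f t)))%C.

Definition is_monic_Szego (R : realType)
    (mu : {finite_measure set (measurableTypeR R) -> \bar R})
    (m : nat) (rho : {poly R[i]}) : Prop :=
  [/\ rho \is monic, size rho = m.+1 &
      forall g : {poly R[i]}, (size g <= m)%N ->
        cintegral mu (fun t => rho.[cis t] * (g.[cis t])^*%C) = 0].

(* z ^+ m * conj (rho (1 / conj z)), as a polynomial; see [reversedE]. *)
Definition reversed (R : realType) (m : nat) (rho : {poly R[i]}) : {poly R[i]} :=
  \poly_(i < m.+1) (rho`_(m - i))^*%C.

Lemma reversedE (R : realType) (m : nat) (rho : {poly R[i]}) (z : R[i]) :
  size rho = m.+1 -> z != 0 ->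
  (reversed m rho).[z] = z ^+ m * (rho.[1 / z^*%C])^*%C.
Proof.
move=> rhoS z0; rewrite horner_poly horner_coef rhoS rmorph_sum mulr_sumr /=.
rewrite (reindex_inj rev_ord_inj) /=; apply: eq_bigr => i _.
have im : (i <= m)%N by rewrite -ltnS.
rewrite subSS subKn // div1r rmorphM rmorphXn /= -conjc_inv conjcK.
rewrite mulrCA; congr (_ * _).
by rewrite exprVn expfB_cond ?(negPf z0) // ?add0n.
Qed.

Definition tau (R : realType) (m : nat) (rho : {poly R[i]}) (z0 : circle R) : R[i] :=
  - rho.[sval z0] / (reversed m rho).[sval z0].

Definition paraorthogonal (R : realType) (m : nat) (rho : {poly R[i]})
    (z0 : circle R) : {poly R[i]} :=
  rho + tau m rho z0 *: reversed m rho.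

(* xi_0, ..., xi_(m-1) are all the zeros of B, pairwise distinct, listed
   counterclockwise from xi_0 = e^(i theta0). *)
Definition ccw_zeros (R : realType) (m : nat) (theta0 : R) (B : {poly R[i]})
    (xi : 'I_m -> circle R) : Prop :=
  (forall z : R[i], root B z <-> exists k, z = sval (xi k)) /\
  exists t : 'I_m -> R,
    [/\ forall k, xi k = expi (t k),
        forall k, theta0 <= t k < theta0 + 2 * pi,
        forall k, nat_of_ord k = 0%N -> t k = theta0 &
        forall k l : 'I_m, (k < l)%N -> t k < t l].

(* Upsilon_m = range zt. *)
Definition closest_nodes (R : realType) (m : nat) (theta0 : R) (N : nat)
    (xi zt : 'I_m -> circle R) : Prop :=
  [/\ injective zt,
      forall k, nodes theta0 N (zt k),
      forall k, nat_of_ord k = 0%N -> zt k = node theta0 N 0 &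
      forall k : 'I_m, (0 < k)%N -> forall z, nodes theta0 N z ->
        `|sval (xi k) - sval (zt k)| <= `|sval (xi k) - sval z|].

Definition interpolants (R : realType) (m r p : nat) (F : circle R -> R[i])
    (zt : 'I_m -> circle R) : set (circle R -> R[i]) :=
  [set L | Laurent (- p%:Z) (r%:Z - p%:Z - 1) L /\
           forall k, L (zt k) = F (zt k)].

Definition norm2 (R : realType) (m : nat) (theta0 : R) (N : nat)
    (zt : 'I_m -> circle R) (phi : circle R -> R[i]) : R :=
  Num.sqrt (\sum_(z \in nodes theta0 N `\` range zt)
              (ComplexField.Normc.normc (phi z)) ^+ 2).

Definition is_minimizer (R : realType) (T : Type) (A : set T) (J : T -> R)
    (x : T) : Prop :=
  A x /\ forall y, A y -> J x <= J y.

(* Main.v *)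
Require Import Defs.
From mathcomp Require Import all_boot all_order all_algebra.
From mathcomp Require Import complex.
From mathcomp Require Import all_classical all_reals all_analysis.
From mathcomp Require Import ring lra zify.
From mathcomp Require sesquilinear spectral.

Import Order.TTheory GRing.Theory Num.Theory.
Import numFieldNormedType.Exports.

Local Open Scope classical_set_scope.
Local Open Scope ring_scope.

(** The problem is a projection onto an affine subspace of C^N.  Every
    admissible L agrees with F on Upsilon_m, so the sum over Z_N \ Upsilon_m
    equals the sum over all of Z_N: the objective is the squared Hermitian
    distance, in C^N, between the vector of values of F at the nodes and the
    vector of values of L ([norm2E]).

    Write L = z^(-p) P with deg P < r ([LaurentP]).  The constraints prescribe P
    at m < r distinct points, hence, by interpolation, the admissible P are
    P0 + om Q with om the monic polynomial vanishing at these m points and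
    deg Q < r - m.  Their value vectors form an affine subspace, and the
    Pythagorean identity gives
      dist(L)^2 = dist(Lmin)^2 + |V(Lmin) - V(L)|^2
    where V denotes the value vector and Lmin an admissible function whose value
    vector is the orthogonal projection of that of F
    ([constrained_least_squares]).  So Lmin is a minimizer, and any other
    minimizer takes the same values as Lmin at all nodes.  The N >= r nodes being
    distinct ([node_inj]), two polynomials of degree < r that agree there are
    equal ([poly_eq_on_nodes]), whence uniqueness. *)

(** * Polynomials at distinct points *)

Lemma Vandermonde_unit {K : fieldType} {m : nat} {y : 'I_m -> K} :
  injective y -> Vandermonde m (\row_k y k) \in unitmx.
Proof.
move=> yI; rewrite unitmxE det_Vandermonde unitfE.
apply/prodf_neq0 => i _; apply/prodf_neq0 => j ij.
rewrite !mxE subr_eq0; apply: contraTneq ij => /yI ->.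
by rewrite ltnn.
Qed.

Lemma interpolation {K : fieldType} {m : nat} {y : 'I_m -> K} (g : 'I_m -> K) :
  injective y ->
  exists P : {poly K}, (size P <= m)%N /\ forall k, P.[y k] = g k.
Proof.
move=> /Vandermonde_unit Vu.
exists (rVpoly ((\row_k g k) *m invmx (Vandermonde m (\row_k y k)))).
split=> [|k]; first exact: size_poly.
have /rowP/(_ k) := mulmxKV Vu (\row_k g k).
rewrite !mxE => <-; rewrite horner_poly; apply: eq_bigr => i _.
by rewrite valK !mxE.
Qed.

Lemma poly_eq_on_nodes {K : fieldType} {n : nat} {x : 'I_n -> K}
    {P Q : {poly K}} :
  injective x -> (size P <= n)%N -> (size Q <= n)%N ->
  (forall j, P.[x j] = Q.[x j]) -> P = Q.
Proof.
move=> xI sP sQ PQ; apply/eqP; rewrite -subr_eq0; apply/eqP.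
apply: (@roots_geq_poly_eq0 _ _ [seq x j | j : 'I_n]).
- apply/allP => _ /mapP[j _ ->].
  by rewrite rootE hornerD hornerN PQ subrr.
- by rewrite map_inj_uniq // enum_uniq.
rewrite size_map size_enum_ord (leq_trans (size_polyD _ _)) //.
by rewrite geq_max size_polyN sP.
Qed.

(** * Orthogonal projection and constrained least squares *)

Section LeastSquares.
Import sesquilinear spectral.

Definition normsq {C : numClosedFieldType} {n : nat} (v : 'rV[C]_n) : C :=
  dotmx v v.

Lemma normsqE (C : numClosedFieldType) (n : nat) (v : 'rV[C]_n) :
  normsq v = \sum_j `|v 0 j| ^+ 2.
Proof.
rewrite /normsq dotmxE mxE; apply: eq_bigr => j _.
by rewrite !mxE normCK.
Qed.

Lemma normsq_ge0 (C : numClosedFieldType) (n : nat) (v : 'rV[C]_n) : 0 <= normsq v.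
Proof. exact: (dnorm_ge0 (@dotmx C n)). Qed.

Lemma normsq_eq0 (C : numClosedFieldType) (n : nat) (v : 'rV[C]_n) :
  normsq v = 0 -> v = 0.
Proof. by move/eqP; rewrite (dnorm_eq0 (@dotmx C n)) => /eqP. Qed.

(** The point [u] is the orthogonal projection of [w], and the identity is
    Pythagoras' theorem for the right triangle [w], [u], [v].  The identity,
    rather than a mere inequality, yields both minimality and uniqueness. *)
Lemma nearest_point {C : numClosedFieldType} {k n : nat} (A : 'M[C]_(k, n))
    (w : 'rV[C]_n) :
  exists2 u, (u <= A)%MS &
    forall v, (v <= A)%MS -> normsq (w - v) = normsq (w - u) + normsq (u - v).
Proof.
exists (w *m proj_ortho A) => [|v vA]; first exact: proj_ortho_sub.
set u := w *m _.
have /submxP[D uvD] : (u - v <= A)%MS.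
  by rewrite addmx_sub // ?eqmx_opp // proj_ortho_sub.
rewrite -[w - v](subrKA u) /normsq.
apply: (@hnormDd _ _ _ _ (@dotmx C n)).
change (dotmx (w - u) (u - v) = 0).
rewrite dotmxE uvD trmx_mul map_mxM mulmxA.
have /orthomx1P -> := proj_ortho_compl_sub A w.
by rewrite mul0mx mxE.
Qed.

End LeastSquares.

(** The points [y k] carry the constraints, the points [x j] the quadratic
    objective, with weights [wt j].  The value vectors of the admissible
    polynomials form a translate of the row space of the matrix [A] whose rows
    come from the multiples [om * 'X^i] of the polynomial [om] vanishing at the
    [y k]; the identity is then that of [nearest_point]. *)
Lemma constrained_least_squares {C : numClosedFieldType} {m r n : nat}
    {y : 'I_m -> C} (g : 'I_m -> C) (x wt : 'I_n -> C) (b : 'rV[C]_n) :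
  injective y -> (m <= r)%N ->
  let V P := \row_j (wt j * P.[x j]) in
  let adm (P : {poly C}) := (size P <= r)%N /\ forall k, P.[y k] = g k in
  exists2 P, adm P &
    forall Q, adm Q -> normsq (b - V Q) = normsq (b - V P) + normsq (V P - V Q).
Proof.
move=> yI mr V adm.
have VD P Q : V (P + Q) = V P + V Q.
  by apply/rowP => j; rewrite !mxE hornerD mulrDr.
have [P0 [sP0 P0y]] := interpolation g yI.
pose om := \prod_(k < m) ('X - (y k)%:P).
have om0 k : om.[y k] = 0.
  by rewrite horner_prod (bigD1 k) //= hornerXsubC subrr mul0r.
have som : size om = m.+1.
  by rewrite size_prod_XsubC [index_enum _]unlock -enumT size_enum_ord.
pose A := \matrix_(i < r - m) V (om * 'X^i).
have VA (c : 'rV_(r - m)) : c *m A = V (om * rVpoly c).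
  apply/rowP => j; rewrite !mxE hornerM horner_poly !mulr_sumr.
  by apply: eq_bigr => i _; rewrite valK !mxE hornerM hornerXn; ring.
have sub Q : adm Q -> (V Q - V P0 <= A)%MS.
  move=> [sQ Qy]; have : om %| Q - P0.
    rewrite /om -(big_map y xpredT (fun z => 'X - z%:P)).
    apply: uniq_roots_dvdp.
      apply/allP => _ /mapP[k _ ->].
      by rewrite rootE hornerD hornerN Qy P0y subrr.
    by rewrite uniq_rootsE map_inj_uniq // index_enum_uniq.
  move=> /dvdpP[q qE].
  have sq : (size q <= r - m)%N.
    have [->|q0] := eqVneq q 0; first by rewrite size_poly0.
    have : (size (Q - P0)%R <= r)%N.
      rewrite (leq_trans (size_polyD _ _)) // geq_max size_polyN sQ.
      exact: leq_trans sP0 mr.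
    rewrite qE size_Mmonic ?monic_prod_XsubC // som addnS /= => sqm.
    by rewrite leq_subRL // addnC.
  apply/submxP; exists (poly_rV q); rewrite VA poly_rV_K // mulrC -qE.
  by apply/eqP; rewrite subr_eq -VD subrK.
have [u /submxP[c uE] umin] := nearest_point A (b - V P0).
exists (P0 + om * rVpoly c).
  split=> [|k]; last by rewrite hornerD hornerM om0 mul0r addr0.
  rewrite (leq_trans (size_polyD _ _)) // geq_max (leq_trans sP0) //=.
  rewrite (leq_trans (size_polyMleq _ _)) // som addSn /=.
  by rewrite -[leqRHS](subnKC mr) leq_add2l size_poly.
move=> Q /sub /umin; rewrite uE VA VD opprB addrA subrK => ->.
by congr (_ + _); congr normsq; [rewrite opprD addrA | rewrite addrCA addrA].
Qed.

(** * Nodes on the circle and Laurent polynomials *)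

(** Equal values of [cis] give [cos (t - s) = 1], that is
    [sin ((t - s) / 2) = 0], which fails when [0 < t - s < 2 * pi]. *)
Lemma cis_inj {R : realType} {a s t : R} :
  a <= s < a + 2 * pi -> a <= t < a + 2 * pi -> cis s = cis t -> s = t.
Proof.
wlog st : s t / s < t => [wl sa ta est|].
  case: (ltgtP s t) => // [/wl|ts]; first exact.
  by apply/esym/(wl t s).
move=> /andP[s1 _] /andP[_ t2] [ec es]; exfalso.
have : cos (t - s) = 1 by rewrite cosB ec es -!expr2 cos2Dsin2.
have -> : t - s = ((t - s) / 2) *+ 2 by rewrite mulr2n -splitr.
rewrite cos_mulr2n cos2sin2 => e1.
have h : 0 < sin ((t - s) / 2) by apply: sin_gt0_pi; apply/andP; split; lra.
have := exprn_gt0 2 h; lra.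
Qed.

Lemma node_inj {R : realType} {theta0 : R} {N : nat} :
  {in `I_N &, injective (node theta0 N)}.
Proof.
have arc j : (j < N)%N ->
    theta0 <= theta0 + 2 * pi / N%:R * j%:R < theta0 + 2 * pi.
  move=> jN; have N0 : (0 < N%:R :> R) by rewrite ltr0n (leq_ltn_trans _ jN).
  have p0 := pi_gt0 R.
  rewrite lerDl ltrD2l; apply/andP; split.
    by rewrite mulr_ge0 // divr_ge0 // ?ltW // mulr_gt0.
  by rewrite -mulrA gtr_pMr ?mulr_gt0 // mulrC ltr_pdivrMr // mul1r ltr_nat.
move=> i j; rewrite !inE /= => iN jN [] ec es.
have N0 : (N%:R != 0 :> R) by rewrite pnatr_eq0 -lt0n (leq_ltn_trans _ iN).
have /addrI/mulfI :
    theta0 + 2 * pi / N%:R * i%:R = theta0 + 2 * pi / N%:R * j%:R.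
  by apply: (cis_inj (arc _ iN) (arc _ jN)); rewrite /cis ec es.
have h0 : 2 * pi / N%:R != 0 :> R.
  by rewrite !mulf_neq0 ?invr_neq0 ?(lt0r_neq0 (pi_gt0 R)) ?pnatr_eq0 -?lt0n
    ?(leq_ltn_trans _ iN).
by move=> /(_ h0)/eqP; rewrite eqr_nat => /eqP.
Qed.

Lemma circle_neq0 {R : realType} (z : circle R) : sval z != 0.
Proof. by rewrite -normr_eq0 (eqP (svalP z)) oner_eq0. Qed.

Lemma LaurentP {R : realType} {a b : int} {n : nat} (L : circle R -> R[i]) :
  b - a = n%:Z ->
  Laurent a b L <-> exists2 P : {poly R[i]}, (size P <= n.+1)%N &
                      forall z, L z = sval z ^ a * P.[sval z].
Proof.
move=> ba; rewrite /Laurent ba /=.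
split=> [[c Lc]|[P sP LP]].
  exists (\poly_(i < n.+1) c (inord i)) => [|z]; first exact: size_poly.
  rewrite Lc horner_poly mulr_sumr; apply: eq_bigr => i _.
  by rewrite inord_val expfzDr ?circle_neq0 // mulrCA.
exists (fun i => P`_i) => z.
rewrite LP (horner_coef_wide _ sP) mulr_sumr; apply: eq_bigr => i _.
by rewrite expfzDr ?circle_neq0 // mulrCA.
Qed.

(** The terms that [norm2] omits vanish when [phi] does on [range zt], so the
    sum can be taken over all the nodes. *)
Lemma norm2E {R : realType} {m : nat} (theta0 : R) (N : nat)
    {zt : 'I_m -> circle R} {phi : circle R -> R[i]} :
  (forall k, phi (zt k) = 0) ->
  ((norm2 theta0 N zt phi ^+ 2)%:C)%C =
    normsq (\row_(j < N) phi (node theta0 N j)).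
Proof.
move=> phi0; rewrite normsqE sqr_sqrtr; last first.
  by apply: fsumr_ge0 => z _; exact: sqr_ge0.
rewrite (@fsbig_widen _ _ _ _ _ (nodes theta0 N)).
- rewrite fsbig_image; last exact: node_inj.
  rewrite -fsbig_ord rmorph_sum; apply: eq_bigr => j _ /=.
  by rewrite mxE rmorphXn.
- exact: subDsetl.
move=> z [_ /not_andP[|/contrapT [k _ <-]]] //=.
by rewrite phi0 ComplexField.Normc.normc0 expr0n.
Qed.

Theorem theorem1 (R : realType) (m r N p : nat)
    (hm : (0 < m)%N) (hmr : (m < r)%N) (hrN : (r <= N)%N) (hp : (p <= r - 1)%N)
    (theta0 : R) (htheta0 : 0 <= theta0 < 2 * pi)
    (mu : {finite_measure set (measurableTypeR R) -> \bar R})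
    (hmu : mu (~` angles R) = 0%E)
    (hsupp : infinite_set (msupport mu))
    (rho : {poly R[i]}) (hrho : is_monic_Szego mu m rho)
    (xi : 'I_m -> circle R)
    (hxi : ccw_zeros theta0 (paraorthogonal m rho (node theta0 N 0)) xi)
    (zt : 'I_m -> circle R) (hzt : closest_nodes theta0 N xi zt)
    (F : circle R -> R[i]) :
  exists! L : circle R -> R[i],
    is_minimizer (interpolants r p F zt)
      (fun L => norm2 theta0 N zt (F \- L) ^+ 2) L.
Proof.
have r0 : (0 < r)%N by apply: leq_ltn_trans hmr.
have width : r%:Z - p%:Z - 1 - - p%:Z = r.-1%:Z by lia.
have ztI : injective (fun k => sval (zt k)).
  by case: hzt => zI _ _ _ k l /val_inj/zI.
pose x (j : 'I_N) := sval (node theta0 N j).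
have xI : injective x.
  by move=> i j /val_inj/node_inj ij; apply/val_inj/ij; rewrite inE /=.
pose lift (P : {poly R[i]}) (z : circle R) := sval z ^ (- p%:Z) * P.[sval z].
(* The value that P must take at zt k for z^(-p) P to agree with F there. *)
pose g k := sval (zt k) ^ p%:Z * F (zt k).
pose b := \row_(j < N) F (node theta0 N j).
have [P [sP Pg] Pmin] :=
  constrained_least_squares g x (fun j => x j ^ (- p%:Z)) b ztI (ltnW hmr).
pose V (Q : {poly R[i]}) := \row_j (x j ^ (- p%:Z) * Q.[x j]).
have liftP L : interpolants r p F zt L <->
    exists Q : {poly R[i]},
      [/\ (size Q <= r)%N, forall k, Q.[sval (zt k)] = g k & L = lift Q].
  split=> [[/(LaurentP _ width)[Q]]|[Q [sQ Qg ->]]].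
    rewrite prednK // => sQ LQ LF; exists Q; split=> [//|k|]; last exact/funext.
    by rewrite /g -LF LQ mulrA -expfzDr ?circle_neq0 // subrr expr0z mul1r.
  split=> [|k]; first by apply/(LaurentP _ width); exists Q; rewrite ?prednK.
  by rewrite /lift Qg mulrA -expfzDr ?circle_neq0 // addNr expr0z mul1r.
have normV L Q : interpolants r p F zt L -> L = lift Q ->
    ((norm2 theta0 N zt (F \- L) ^+ 2)%:C)%C = normsq (b - V Q).
  move=> [_ LF] LQ; rewrite norm2E => [|k]; last by rewrite /= LF subrr.
  by congr normsq; apply/rowP => j; rewrite !mxE /= LQ.
have admP : interpolants r p F zt (lift P) by apply/liftP; exists P.
exists (lift P); split=> [|L [/[dup] admL /liftP[Q [sQ Qg LQ]]]].
  split=> // L /[dup] admL /liftP[Q [sQ Qg LQ]].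
  rewrite -lecR (normV _ _ admP erefl) (normV _ _ admL LQ) [leRHS]Pmin //.
  by rewrite lerDl normsq_ge0.
move=> /(_ _ admP); rewrite -lecR (normV _ _ admP erefl) (normV _ _ admL LQ).
rewrite [leLHS]Pmin // gerDl => le0.
have /normsq_eq0/rowP PQ : normsq (V P - V Q) = 0.
  by apply/le_anti; rewrite le0 normsq_ge0.
rewrite LQ; congr lift; apply: (poly_eq_on_nodes xI) => [||j].
- exact: leq_trans hrN.
- exact: leq_trans hrN.
have /eqP := PQ j; rewrite !mxE subr_eq0 => /eqP/mulfI; apply.
by rewrite expfz_neq0 ?circle_neq0.
Qed.
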